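(* Let $A\subseteq[\omega]^{<\omega}$ be a decidable subset of $\omega$ that is omnipresent. (i) For all positive integers $k,r$ and every $\chi\in r^\omega$, the set $B(A,k,r,\chi):=\{s\in A\mid s\text{ is }(\chi,k)\text{-monochromatic}\}$ is omnipresent. (ii) For all positive integers $k,r$, the set $$C(A,k,r):=\{s\in[\omega]^{<\omega}\mid\forall\chi\in r^\omega\,\exists t\in[\omega]^{<\omega}[s\circ t\in A\wedge s\circ t\text{ is }(\chi,k)\text{-monochromatic}]\}$$ is a bar in $[\omega]^\omega$, i.e. $\forall\zeta\in[\omega]^\omega\,\exists n[\langle\zeta(0),\dots,\zeta(n-1)\rangle\in C(A,k,r)]$.
   Context: Setting: intuitionistic mathematics (intuitionistic logic), assuming the axioms of countable choice, Brouwer's Fan Theorem (if $\beta$ is a finitary spread-law and $B\subseteq\omega$ is a bar in $\mathcal{F}_\beta$, some finite $B'\subseteq B$ is a bar in $\mathcal{F}_\beta$; in particular this applies to $r^\omega$) and Brouwer's Bar Theorem in the form of Bar Induction (if $B,C\subseteq\omega$, $B$ is a bar in $\omega^\omega$, $B\subseteq C$ and $\forall s[s\in C\leftrightarrow\forall n[s\ast\langle n\rangle\in C]]$, then $\langle\,\rangle\in C$). Finite sequences of natural numbers are coded bijectively by natural numbers. $[\omega]^n$ is the set of (codes of) strictly increasing sequences of length $n$, $[\omega]^{<\omega}=\bigcup_n[\omega]^n$, $[n]^k=\{s\in[\omega]^k\mid\forall i<k[s(i)<n]\}$, $[\omega]^\omega$ the strictly increasing elements of $\omega^\omega$. For finite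 sequences (or infinite sequences) $s$ and finite $t$ with all $t(i)<\mathrm{length}(s)$, $s\circ t$ is (the code of) $\langle s(t(0)),\dots,s(t(\mathrm{length}(t)-1))\rangle$. $A\subseteq[\omega]^{<\omega}$ is omnipresent iff $\forall\zeta\in[\omega]^\omega\,\exists s\in[\omega]^{<\omega}[\zeta\circ s\in A]$. For a positive integer $r$, $r^\omega=\{\chi\in\omega^\omega\mid\forall i[\chi(i)<r]\}$. For $s\in[\omega]^n$ and $\chi\in\omega^\omega$, $s$ is $(\chi,k)$-monochromatic iff $\forall t\in[n]^k\,\forall u\in[n]^k[\chi(s\circ t)=\chi(s\circ u)]$. Decidable subset of $\omega$: one with a characteristic function in $\omega^\omega$. *)

(* Defs.v *)
From mathcomp Require Import all_boot.

Set Implicit Arguments.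
Unset Strict Implicit.
Unset Printing Implicit Defensive.

(* A subset of omega is handled through the bijection
   CodeSeq.code : seq nat -> nat as a set of finite sequences,
   seq nat -> Prop.  Elements of omega^omega are functions nat -> nat; they are
   applied to (the code of) a finite sequence through CodeSeq.code. *)

Definition sub_set (B C : seq nat -> Prop) : Prop := forall s, B s -> C s.

Definition decidable_set (A : seq nat -> Prop) : Prop :=
  exists alpha : nat -> nat,
    forall s, alpha (CodeSeq.code s) < 2 /\ (A s <-> alpha (CodeSeq.code s) = 1).

(* [omega]^{<omega} *)
Definition fin_incr (s : seq nat) : Prop := sorted ltn s.

(* [omega]^k *)
Definition fin_incr_of_size (k : nat) (s : seq nat) : Prop :=
  fin_incr s /\ size s = k.

(* [n]^k *)
Definition fin_incr_below (n k : nat) (s : seq nat) : Prop :=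
  fin_incr_of_size k s /\ forall i, i < k -> nth 0 s i < n.

(* [omega]^omega *)
Definition inf_incr (zeta : nat -> nat) : Prop := forall i, zeta i < zeta i.+1.

(* omega^omega *)
Definition baire (alpha : nat -> nat) : Prop := True.

(* r^omega *)
Definition colouring (r : nat) (chi : nat -> nat) : Prop := forall i, chi i < r.

(* s o t, meaningful only if every entry of t is smaller than size s *)
Definition composable (s t : seq nat) : Prop :=
  forall i, i < size t -> nth 0 t i < size s.

Definition comp_seq (s t : seq nat) : seq nat := [seq nth 0 s i | i <- t].

Definition comp_inf (zeta : nat -> nat) (t : seq nat) : seq nat :=
  [seq zeta i | i <- t].

Definition bar (X : (nat -> nat) -> Prop) (B : seq nat -> Prop) : Prop :=
  forall alpha, X alpha -> exists n, B (mkseq alpha n).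

Definition omnipresent (A : seq nat -> Prop) : Prop :=
  forall zeta, inf_incr zeta -> exists s, fin_incr s /\ A (comp_inf zeta s).

Definition monochromatic (chi : nat -> nat) (k : nat) (s : seq nat) : Prop :=
  forall t u, fin_incr_below (size s) k t -> fin_incr_below (size s) k u ->
    chi (CodeSeq.code (comp_seq s t)) = chi (CodeSeq.code (comp_seq s u)).

Definition mono_part (A : seq nat -> Prop) (k r : nat) (chi : nat -> nat)
    (s : seq nat) : Prop :=
  A s /\ monochromatic chi k s.

Definition ramsey_set (A : seq nat -> Prop) (k r : nat) (s : seq nat) : Prop :=
  fin_incr s /\
  forall chi, colouring r chi ->
    exists t, [/\ fin_incr t, composable s t, A (comp_seq s t)
                & monochromatic chi k (comp_seq s t)].

(* Only the instances T = nat and T = nat -> nat, choosing numbers and elements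
   of omega^omega respectively, are used below. *)
Definition countable_choice (T : Type) : Prop :=
  forall R : nat -> T -> Prop,
    (forall m, exists x, R m x) -> exists f : nat -> T, forall m, R m (f m).

(* A finite sequence s is admitted by beta when beta (code s) = 0. *)
Definition spread_law (beta : nat -> nat) : Prop :=
  forall s, beta (CodeSeq.code s) = 0 <->
            exists n, beta (CodeSeq.code (rcons s n)) = 0.

Definition finitary (beta : nat -> nat) : Prop :=
  forall s, beta (CodeSeq.code s) = 0 ->
    exists n, forall m, beta (CodeSeq.code (rcons s m)) = 0 -> m <= n.

Definition spread (beta alpha : nat -> nat) : Prop :=
  forall n, beta (CodeSeq.code (mkseq alpha n)) = 0.

Definition fan_theorem : Prop :=
  forall (beta : nat -> nat) (B : seq nat -> Prop),
    spread_law beta -> finitary beta -> bar (spread beta) B ->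
    exists B' : seq (seq nat),
      sub_set (fun s => s \in B') B /\ bar (spread beta) (fun s => s \in B').

Definition bar_induction : Prop :=
  forall B C : seq nat -> Prop,
    bar baire B -> sub_set B C ->
    (forall s, C s <-> forall n, C (rcons s n)) ->
    C [::].

(* Main.v *)
Require Import Defs.
From mathcomp Require Import all_boot.

(** The proof is intuitionistic and goes by induction on [k], starting from the
    trivial case [k = 0].  Part (ii) for [k] follows from part (i) for [k] and
    the Fan Theorem, since being monochromatic depends on finitely many values
    of the colouring only.  Part (i) for [k + 1] follows from part (ii) for [k]
    once the bar [C(A, k, r)] is known to contain, for every colouring [chi], a
    sequence [s] on which the colour of a [k + 1]-subset only depends on its
    first [k] elements, say through [delta]: a subsequence of [s] that is
    monochromatic for [delta] is monochromatic for [chi].  Such an [s] is found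
    by Bar Induction, a constructive rendering of the Erdos-Rado tree argument:
    the nodes are the pairs [(s, delta)], and one shows that, unless the wanted
    sequence exists, every infinite set has an element that does not fit
    [(s, delta)]. *)

Notation code := CodeSeq.code.

(** * Increasing sequences, subsequences and monochromaticity *)

Lemma inf_incr_lt {zeta} : inf_incr zeta -> {mono zeta : i j / i < j}.
Proof.
move=> zetaP; apply/leqW_mono/leq_mono => i j.
exact: homo_ltn ltn_trans zetaP i j.
Qed.

Lemma inf_incr_comp {zeta eta} :
  inf_incr zeta -> inf_incr eta -> inf_incr (zeta \o eta).
Proof. by move=> zetaP etaP i; rewrite /= (inf_incr_lt zetaP). Qed.

Lemma inf_incr_shift {zeta} n : inf_incr zeta -> inf_incr (fun i => zeta (n + i)).
Proof. by move=> zetaP i; rewrite addnS. Qed.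

Lemma inf_incr_ge {zeta} : inf_incr zeta -> forall i, i <= zeta i.
Proof. by move=> zetaP; elim=> // i IHi; apply: leq_ltn_trans IHi _. Qed.

Lemma mkseq_inf_incr {zeta} n : inf_incr zeta -> fin_incr (mkseq zeta n).
Proof.
move=> zetaP; rewrite /fin_incr /mkseq sorted_map.
by rewrite (eq_sorted (e' := ltn)) ?iota_ltn_sorted // => i j /=; rewrite inf_incr_lt.
Qed.

Lemma comp_seq_subseq {s t} :
  fin_incr t -> composable s t -> subseq (comp_seq s t) s.
Proof.
move=> t_incr st; rewrite -[s in subseq _ s](mkseq_nth 0); apply: map_subseq.
(* An increasing [t] with entries below [size s] is a filtered initial segment of the naturals. *)
rewrite (_ : t = [seq i <- iota 0 (size s) | i \in t]) ?filter_subseq //.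
apply: (irr_sorted_eq ltn_trans ltnn) => // [|i].
  by rewrite sorted_filter ?iota_ltn_sorted //; apply: ltn_trans.
rewrite mem_filter mem_iota add0n /=.
by case: (boolP (i \in t)) => // /(nthP 0)[j jt <-]; rewrite st.
Qed.

Lemma subseq_comp_seq {u s} :
  subseq u s -> exists2 t, fin_incr t /\ composable s t & u = comp_seq s t.
Proof.
move=> /subseqP[m _ ->]; exists (mask m (iota 0 (size s))); last first.
  by rewrite /comp_seq map_mask -/(mkseq _ _) mkseq_nth.
split; first exact: (sorted_mask ltn_trans _ (iota_ltn_sorted _ _)).
by move=> i /(mem_nth 0)/mem_mask; rewrite mem_iota.
Qed.

(** Trading index sequences for subsequences lets later arguments work with masks and [subseq]
    instead of compositions. *)
Lemma monochromaticP chi k s :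
  monochromatic chi k s <->
  {in [pred u | subseq u s & size u == k] &,
    forall u v, chi (code u) = chi (code v)}.
Proof.
split=> [mono u v | mono t u].
  have below t : fin_incr t -> composable s t -> size (comp_seq s t) == k ->
      fin_incr_below (size s) k t.
    by move=> t_incr ts; rewrite size_map => /eqP <-.
  move=> /andP[/subseq_comp_seq[t [t_incr ts] ->] kt].
  move=> /andP[/subseq_comp_seq[t' [t'_incr ts'] ->] kt'].
  by apply: mono; apply: below.
have subseq_k v : fin_incr_below (size s) k v ->
    comp_seq s v \in [pred u | subseq u s & size u == k].
  case=> -[v_incr vk] vs; rewrite inE /= size_map vk eqxx andbT.
  by apply: comp_seq_subseq => // i; rewrite vk => /vs.
by move=> /subseq_k ts /subseq_k us; apply: mono.
Qed.

Definition subseqs_of_size k (s : seq nat) : seq (seq nat) :=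
  [seq u <- codom (fun b : (size s).-tuple bool => mask b s) | size u == k].

Lemma mem_subseqs_of_size k s u :
  (u \in subseqs_of_size k s) = subseq u s && (size u == k).
Proof.
rewrite mem_filter andbC; congr andb; apply/codomP/subseqP => [[b ->]|[m ms ->]].
  by exists b; rewrite ?size_tuple.
by move/eqP in ms; exists (Tuple ms).
Qed.

Lemma bigmax_code_bound (l : seq (seq nat)) :
  exists n, forall u, u \in l -> code u < n.
Proof.
exists (\max_(u <- l) code u).+1 => u ul; rewrite ltnS.
exact: (leq_bigmax_seq u).
Qed.

(** * Sets meeting every infinite set, a constructive substitute for cofinite sets *)

Definition meets_every_infinite (F : nat -> Prop) : Prop :=
  forall zeta, inf_incr zeta -> exists i, F (zeta i).

(** Choice yields an infinite subsequence [zeta \o g] lying entirely in [F]; then [G] meets it. *)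
Lemma meets_every_infinite_and F G : countable_choice nat ->
  meets_every_infinite F -> meets_every_infinite G ->
  meets_every_infinite (fun m => F m /\ G m).
Proof.
move=> AC00 metF metG zeta zetaP.
have [f Ff] := AC00 (fun m i => F (zeta (m + i)))
                 (fun m => metF _ (inf_incr_shift m zetaP)).
pose h m := m + f m; pose g i := iter i (fun m => h m.+1) (h 0).
have gP : inf_incr g by move=> i; rewrite /= /h addSn ltnS leq_addr.
have [i Gi] := metG _ (inf_incr_comp zetaP gP).
by exists (g i); split=> //; case: i {Gi} => [|i]; apply: Ff.
Qed.

Lemma meets_every_infinite_forall (F : nat -> nat -> Prop) r :
  countable_choice nat -> (forall j, j < r -> meets_every_infinite (F j)) ->
  meets_every_infinite (fun m => forall j, j < r -> F j m).
Proof.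
move=> AC00; elim: r => [|r IHr] metF zeta zetaP; first by exists 0.
have [|i [Fi Fr]] := meets_every_infinite_and _ _ AC00 (IHr _) (metF r (leqnn _)) _ zetaP.
  by move=> j jr; apply: metF (ltnW _).
by exists i => j; rewrite ltnS leq_eqVlt => /predU1P[->|/Fi].
Qed.

(** Bar Induction concerns all sequences, so [alpha] is replaced by an increasing [alpha'] that
    agrees with it on every increasing initial segment. *)
Lemma bar_inf_incr_baire D : bar inf_incr D -> bar baire (fun s => fin_incr s -> D s).
Proof.
move=> barD alpha _.
pose alpha' := fix f n := if n is m.+1 then maxn (alpha n) (f m).+1 else alpha 0.
have alpha'P : inf_incr alpha' by move=> i /=; rewrite leq_max leqnn orbT.
have [n Dn] := barD alpha' alpha'P; exists n => alpha_incr.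
suff -> : mkseq alpha n = mkseq alpha' n by [].
apply/(@eq_from_nth _ 0); rewrite ?size_mkseq // => i ltin; rewrite !nth_mkseq //.
elim: i ltin => // i IHi ltin; rewrite /= -IHi 1?ltnW //; apply/esym/maxn_idPl.
have := sorted_ltn_nth ltn_trans 0 alpha_incr i i.+1.
by rewrite !inE !size_mkseq !nth_mkseq // 1?ltnW //; apply.
Qed.

(** * End-homogeneous sequences from Bar Induction *)

Section EndHomogeneous.

Context (chi : nat -> nat) (k r : nat).
Hypothesis chi_r : colouring r chi.

Definition fits (K : seq (seq nat)) (delta : nat -> nat) (m : nat) : bool :=
  all (fun u => chi (code (rcons u m)) == delta (code u)) K.

(** Here [delta] is a total function, so that it can itself serve as a colouring in [ramsey_set]. *)
Definition end_homogeneous (delta : nat -> nat) (s : seq nat) : Prop :=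
  fin_incr s /\ forall u m, size u = k -> subseq (rcons u m) s ->
    chi (code (rcons u m)) = delta (code u).

(* The colours at a new [u] are tried one by one: an [m] that fits no extension
   of [delta] at [u], in particular not the one taking the value
   [chi (u * m)], must already misfit [delta] on [K].  Carrying the disjunct
   [G] along avoids having to decide [G]. *)
Lemma misfit_restrict (G : Prop) K L delta :
  countable_choice nat -> colouring r delta ->
  (forall delta', colouring r delta' ->
     {in K, forall u, delta' (code u) = delta (code u)} ->
     meets_every_infinite (fun m => G \/ ~~ fits (K ++ L) delta' m)) ->
  meets_every_infinite (fun m => G \/ ~~ fits K delta m).
Proof.
move=> AC00; elim: L K delta => [|u L IHL] K delta delta_r misfit.
  by have := misfit delta delta_r; rewrite cats0; apply.
case: (boolP (u \in K)) => [uK | uK].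
  apply: IHL => // delta' delta'_r agree zeta zetaP.
  have [i Gi] := misfit delta' delta'_r agree zeta zetaP; exists i.
  case: Gi => [|unfit]; [by left | right; apply: contra unfit].
  by rewrite /fits !all_cat /= => /andP[fitK ->]; rewrite fitK (allP fitK _ uK).
pose delta_ j := [eta delta with code u |-> j].
have delta_u j : j < r -> meets_every_infinite
    (fun m => G \/ ~~ fits (rcons K u) (delta_ j) m).
  move=> jr; apply: IHL => [i | delta' delta'_r agree].
    by rewrite /=; case: ifP.
  rewrite cat_rcons; apply: misfit => // v vK.
  rewrite agree ?mem_rcons ?inE ?vK ?orbT //=.
  by rewrite (can_eq CodeSeq.codeK) (negPf (memPn uK _ vK)).
move=> zeta /(meets_every_infinite_forall _ _ AC00 delta_u)[i misfit_i].
exists i; have [|unfit] := misfit_i _ (chi_r (code (rcons u (zeta i)))).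
  by left.
right; apply: contra unfit => /allP fitK.
rewrite /fits all_rcons /= eqxx eqxx /=; apply/allP => v vK.
by rewrite (can_eq CodeSeq.codeK) (negPf (memPn uK _ vK)) fitK.
Qed.

Lemma exists_end_homogeneous D : countable_choice nat -> bar_induction ->
  0 < r -> bar inf_incr D ->
  exists s delta, [/\ colouring r delta, end_homogeneous delta s & D s].
Proof.
move=> AC00 BI r_gt0 /bar_inf_incr_baire barD; set G := exists s, _.
pose C s := forall delta, colouring r delta -> end_homogeneous delta s ->
  meets_every_infinite (fun m => G \/ ~~ fits (subseqs_of_size k s) delta m).
(* Every number fits the empty list, so at the root only [G] remains. Passing through
   [misfit_restrict] covers [k = 0], where the list at the root is not empty. *)
suff Cnil : C [::].
  have misfit : meets_every_infinite (fun m => G \/ ~~ fits [::] (fun=> 0) m).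
    apply: (misfit_restrict G [::] (subseqs_of_size k [::]) _ AC00) => // delta.
    by move=> delta_r _; apply: Cnil => //; split=> // u m _; rewrite subseq0; case: u.
  by have [i [|]] := misfit id (fun=> ltnSn _).
apply: (BI _ C barD) => [s Ds delta delta_r hom zeta _ | s].
  by exists 0; left; exists s, delta; split=> //; apply: Ds; case: hom.
split=> [Cs x delta delta_r [s_incr hom] zeta zetaP
        | Cs delta delta_r [s_incr hom] zeta zetaP].
  have sub_s := subseq_rcons s x.
  have [|i [Gi | unfit]] := Cs delta delta_r _ zeta zetaP.
  - split=> [|u m uk um]; first exact: (subseq_sorted ltn_trans sub_s).
    by apply: hom => //; apply: subseq_trans sub_s.
  - by exists i; left.
  exists i; right; apply: contra unfit => /allP fit; apply/allP => u.
  rewrite mem_subseqs_of_size => /andP[us uk]; apply: fit.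
  by rewrite mem_subseqs_of_size uk (subseq_trans us sub_s).
(* Since [i <= zeta i], this [x] exceeds the last entry of [s]. If [x] misfits, it is the element
   sought; otherwise [rcons s x] is the next node. *)
set x := zeta ((last 0 s).+1 + 0).
case: (boolP (fits (subseqs_of_size k s) delta x)) => [fit | unfit]; last first.
  by exists ((last 0 s).+1 + 0); right.
have x_incr : fin_incr (rcons s x).
  rewrite /fin_incr; case: s s_incr @x {Cs hom fit} => // y s s_incr /=.
  rewrite rcons_path; rewrite /fin_incr /= in s_incr; rewrite s_incr /= addn0.
  exact: inf_incr_ge.
(* Any [delta'] agreeing with [delta] on the [k]-subsequences of [s] makes [rcons s x]
   end-homogeneous, so [Cs x] applies to it. *)
apply: (misfit_restrict G _ (subseqs_of_size k (rcons s x)) delta AC00) zetaP => //.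
move=> delta' delta'_r agree eta etaP.
have [|i [Gi|unfit]] := Cs x delta' delta'_r _ eta etaP.
- split=> // u m uk.
  have in_s : subseq u s -> u \in subseqs_of_size k s.
    by rewrite mem_subseqs_of_size uk eqxx andbT.
  (* Reversal exposes the last entries: either [m] is [x], which fits, or [rcons u m] already lies
     in [s]. *)
  rewrite -subseq_rev !rev_rcons /=; case: eqP => [-> | _].
    by rewrite subseq_rev => /in_s us; rewrite agree //; apply/eqP/(allP fit).
  rewrite -rev_rcons subseq_rev => ums.
  rewrite agree ?hom //; apply/in_s/(subseq_trans _ ums)/subseq_rcons.
- by exists i; left.
exists i; right; apply: contra unfit.
by rewrite /fits all_cat => /andP[].
Qed.

End EndHomogeneous.

(** * From omnipresence to bars by the Fan Theorem *)

Lemma fan_colouring r B : fan_theorem -> 0 < r -> bar (colouring r) B ->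
  exists B' : seq (seq nat),
    sub_set (fun s => s \in B') B /\ bar (colouring r) (fun s => s \in B').
Proof.
move=> FT r_gt0 barB.
pose beta i : nat := ~~ all (ltn^~ r) (CodeSeq.decode i).
have betaE s : beta (code s) = 0 <-> all (ltn^~ r) s.
  by rewrite /beta CodeSeq.codeK; case: all.
have spreadP alpha : spread beta alpha <-> colouring r alpha.
  split=> [sp i | col n].
    have /betaE/allP/(_ (alpha i)) := sp i.+1; apply; apply: map_f.
    by rewrite mem_iota add0n ltnSn.
  apply/betaE/allP => _ /mapP[i _ ->]; exact: col.
have [|||B' [B'B barB']] := FT beta B.
- move=> s; split=> [/betaE sr | [n /betaE]].
    by exists 0; apply/betaE; rewrite all_rcons /= r_gt0.
  by rewrite all_rcons => /andP[_ /betaE].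
- move=> s _; exists r => m /betaE; rewrite all_rcons => /andP[+ _].
  exact: ltnW.
- by move=> alpha /spreadP; apply: barB.
by exists B'; split=> // alpha /spreadP; apply: barB'.
Qed.

Lemma eq_monochromatic chi chi' k s :
  (forall u, subseq u s -> chi (code u) = chi' (code u)) ->
  monochromatic chi k s -> monochromatic chi' k s.
Proof.
move=> eq_chi /monochromaticP mono; apply/monochromaticP => u v uP vP.
have [/andP[us _] /andP[vs _]] := (uP, vP).
by rewrite -!eq_chi //; apply: mono.
Qed.

(** Prefixes of colourings that already guarantee a monochromatic [t] form a bar. A finite subbar
    needs finitely many such [t], and [N] bounds their entries. *)
Lemma bar_ramsey_set A k r : fan_theorem -> 0 < r ->
  (forall chi, colouring r chi -> omnipresent (mono_part A k r chi)) ->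
  bar inf_incr (ramsey_set A k r).
Proof.
move=> FT r_gt0 omni zeta zetaP.
pose good c t := [/\ fin_incr t, A (comp_inf zeta t)
  & forall chi n, c = mkseq chi n -> monochromatic chi k (comp_inf zeta t)].
have [|B' [B'good barB']] := @fan_colouring r (fun c => exists t, good c t) FT r_gt0.
  move=> chi /omni/(_ zeta zetaP)[t [t_incr [At mono]]].
  (* A prefix of length [n] fixes the colours of all subsequences of [comp_inf zeta t]. *)
  have [n n_gt] := bigmax_code_bound
    (codom (fun b : (size t).-tuple bool => mask b (comp_inf zeta t))).
  exists n, t; split=> // chi' n' eq_mk.
  have eq_n : n' = n by rewrite -(size_mkseq chi n) eq_mk size_mkseq.
  apply: eq_monochromatic mono => u /subseqP[m ms ->].
  have mn : code (mask m (comp_inf zeta t)) < n.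
    apply: n_gt; apply/codomP; rewrite size_map in ms; move/eqP in ms.
    by exists (Tuple ms).
  by rewrite -(nth_mkseq 0 chi mn) eq_mk nth_mkseq // eq_n.
have [N goodN] : exists N, forall c, c \in B' -> exists2 t, good c t & all (ltn^~ N) t.
  elim: {barB'} B' B'good => [|c B' IHB'] B'good; first by exists 0.
  have [|N goodN] := IHB'; first by move=> d dB; apply: B'good; rewrite inE dB orbT.
  have [|t ct] := B'good c; first exact: mem_head.
  exists (maxn N (\max_(i <- t) i).+1) => d; rewrite inE => /predU1P[->|/goodN[u du uN]].
    exists t => //; apply/allP => i it /=.
    by rewrite leq_max ltnS (leq_bigmax_seq i) ?orbT.
  exists u => //; apply: sub_all uN => i /= iN.
  by rewrite leq_max iN.
exists N; split; first exact: mkseq_inf_incr.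
move=> chi /barB'[n /goodN[t [t_incr At mono] /allP tN]]; exists t.
have -> : comp_seq (mkseq zeta N) t = comp_inf zeta t.
  by apply/eq_in_map => i /tN; apply: nth_mkseq.
split=> //; last exact: mono (erefl _).
by move=> i it; rewrite size_mkseq; apply/tN/mem_nth.
Qed.

(** * The induction on the size of the coloured sets *)

Lemma omnipresent_mono_part A k r chi :
  countable_choice nat -> fan_theorem -> bar_induction ->
  0 < r -> omnipresent A -> colouring r chi -> omnipresent (mono_part A k r chi).
Proof.
move=> AC00 FT BI r_gt0.
elim: k A chi => [|k IHk] A chi omniA chi_r zeta zetaP.
  have [s [s_incr As]] := omniA zeta zetaP; exists s; split=> //; split=> //.
  by apply/monochromaticP => u v /andP[_ /nilP->] /andP[_ /nilP->].
(* Pulling [A] and [chi] back along [zeta] reduces the search to sequences of indices; the induction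
   hypothesis is used for [Az]. *)
pose Az s := A (comp_inf zeta s).
pose chiz i := chi (code (comp_inf zeta (CodeSeq.decode i))).
have omniAz : omnipresent Az.
  move=> eta etaP; have [s [s_incr As]] := omniA _ (inf_incr_comp zetaP etaP).
  by exists s; split=> //; rewrite /Az /comp_inf -map_comp.
have barD : bar inf_incr (ramsey_set Az k r).
  by apply: bar_ramsey_set => // delta; apply: IHk.
have chiz_r : colouring r chiz by move=> i; apply: chi_r.
have [s [delta [delta_r [s_incr hom] [_ Ds]]]] :=
  exists_end_homogeneous _ k _ chiz_r _ AC00 BI r_gt0 barD.
(* The set [ramsey_set] serves all colourings at once, hence also [delta], which is only known
   together with [s]. *)
have [t [t_incr ts At /monochromaticP mono]] := Ds delta delta_r.
have sub_s := comp_seq_subseq t_incr ts; set w := comp_seq s t in At mono sub_s.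
exists w; split; first exact: (subseq_sorted ltn_trans sub_s).
split=> //; apply/monochromaticP.
have colour u : subseq u (comp_inf zeta w) -> size u == k.+1 -> exists2 v,
    v \in [pred v | subseq v w & size v == k] & chi (code u) = delta (code v).
  case/subseqP=> m _ ->; rewrite -map_mask size_map.
  have := mask_subseq m w; case/lastP: (mask m w) => // v x vxw.
  rewrite size_rcons eqSS => vk; exists v.
    by rewrite inE vk (subseq_trans (subseq_rcons v x) vxw).
  rewrite -(hom v x) ?(eqP vk) //; last exact: subseq_trans vxw sub_s.
  by rewrite /chiz CodeSeq.codeK.
move=> u v /andP[/colour uP /uP[u' u'P ->]] /andP[/colour vP /vP[v' v'P ->]].
exact: mono.
Qed.

Theorem theorem7p18
  (AC00 : countable_choice nat)
  (AC01 : countable_choice (nat -> nat))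
  (FT : fan_theorem)
  (BI : bar_induction)
  (A : seq nat -> Prop)
  (A_incr : sub_set A fin_incr)
  (A_dec : decidable_set A)
  (A_omni : omnipresent A) :
  (forall (k r : nat) (chi : nat -> nat),
     0 < k -> 0 < r -> colouring r chi -> omnipresent (mono_part A k r chi))
  /\
  (forall k r : nat,
     0 < k -> 0 < r -> bar inf_incr (ramsey_set A k r)).
Proof.
have omni k r chi : 0 < r -> colouring r chi -> omnipresent (mono_part A k r chi).
  by move=> r_gt0; apply: omnipresent_mono_part.
split=> [k r chi _|k r _ r_gt0]; first exact: omni.
by apply: bar_ramsey_set => // chi; apply: omni.
Qed.
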